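(* Let $\mathcal H$ be a real Hilbert space and $f\colon\mathcal H\to\left]-\infty,+\infty\right]$ a proper lower semicontinuous convex Legendre function. Let $T_1,\dots,T_m\colon\mathcal H\to\mathcal H$, $\mathcal S(x)=\{x,T_1x,\dots,T_mx\}$, and $F:=\operatorname{int}\operatorname{dom} f\cap\bigcap_{i=1}^m\operatorname{Fix}T_i$. Suppose that $F$ is nonempty, closed and convex, that each $T_i$ is Bregman isometric with respect to $f$, and that $\overrightarrow{CC}_{\mathcal S}(y)$ contains at most one point for every $y\in\operatorname{int}\operatorname{dom} f$. Let $y\in\operatorname{int}\operatorname{dom} f$. Then: (i) for every $x\in\operatorname{dom} f$ and every $z\in F$, $D_f(x,z)=D_f(T_1x,z)=\cdots=D_f(T_mx,z)$; (ii) for every $z\in F$, $\overrightarrow{CC}_{\mathcal S}(y)=\{\overleftarrow P^f_{\operatorname{aff}(\mathcal S(y))}(z)\}\subseteq\operatorname{int}\operatorname{dom} f$; (iii) the iterates $(\overrightarrow{CC}_{\mathcal S}^{\,k}y)_{k\in\mathbb N}$ form a well-defined sequence in $\operatorname{int}\operatorname{dom} f$; (iv) this sequence is forward Bregman monotone with respect to $\bigcap_{i=1}^m\operatorname{Fix}T_i$; consequently $(D_f(\overrightarrow{CC}_{\mathcal S}^{\,k}y,z))_{k}$ converges for every $z\in F$; (v) $\lim_{k\to\infty}D_f(\overrightarrow{CC}_{\mathcal S}^{\,k}y,\overrightarrow{CC}_{\mathcal S}^{\,k+1}y)=0$; (vi) suppose moreover that each $T_i$ is $f$-demiclosed and that for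 every sequence $(u_k)$ in $\operatorname{int}\operatorname{dom} f$: if $D_f(u_k,\overrightarrow{CC}_{\mathcal S}u_k)\to0$ and $D_f(T_iu_k,\overrightarrow{CC}_{\mathcal S}u_k)\to0$ for all $i$, then $D_f(u_k,T_iu_k)\to0$ for all $i$. Then (a) $\overrightarrow{CC}_{\mathcal S}$ (as a map on $\operatorname{int}\operatorname{dom} f$) is $f$-demiclosed; and (b) if all weak sequential cluster points of $(\overrightarrow{CC}_{\mathcal S}^{\,k}y)_{k}$ lie in $\operatorname{int}\operatorname{dom} f$, then $(\overrightarrow{CC}_{\mathcal S}^{\,k}y)_{k}$ converges weakly to a point of $F$.
   Context: Bregman distance: $D_f(x,y)=f(x)-f(y)-\langle\nabla f(y),x-y\rangle$ if $y\in\operatorname{int}\operatorname{dom} f$, $+\infty$ otherwise. Legendre: $f$ is essentially smooth ($\operatorname{dom}\partial f=\operatorname{int}\operatorname{dom} f\neq\varnothing$, Gâteaux differentiable on $\operatorname{int}\operatorname{dom} f$, $\|\nabla f(x_k)\|\to\infty$ whenever $(x_k)\subseteq\operatorname{int}\operatorname{dom} f$ converges to a boundary point of $\operatorname{dom} f$) and essentially strictly convex ($(\partial f)^{-1}$ locally bounded on its domain and $f$ strictly convex on every convex subset of $\operatorname{dom}\partial f$). Forward Bregman circumcenter mapping: for $y$ with $\mathcal S(y)\subseteq\operatorname{dom} f$, $\overrightarrow{CC}_{\mathcal S}(y)=\{v\in\operatorname{aff}(\mathcal S(y))\cap\operatorname{int}\operatorname{dom} f: D_f(y,v)=D_f(T_1y,v)=\cdots=D_f(T_my,v)\}$;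 when it is a singleton it is identified with its element (so iterates make sense). $\operatorname{aff}$ = affine hull. Backward Bregman projection: $\overleftarrow P^f_C(y)=\{u\in C\cap\operatorname{dom} f: D_f(u,y)\le D_f(c,y)\ \forall c\in C\}$ for $y\in\operatorname{int}\operatorname{dom} f$. Bregman isometry: $T$ is Bregman isometric w.r.t. $f$ if for all $(x,y)\in\operatorname{dom} f\times\operatorname{int}\operatorname{dom} f$, $(Tx,Ty)\in\operatorname{dom} f\times\operatorname{int}\operatorname{dom} f$ and $D_f(Tx,Ty)=D_f(x,y)$. Forward Bregman monotone: $(x_k)$ is forward Bregman monotone w.r.t. $C$ if $C\cap\operatorname{int}\operatorname{dom} f\neq\varnothing$, all $x_k\in\operatorname{int}\operatorname{dom} f$, and $D_f(x_{k+1},c)\le D_f(x_k,c)$ for all $c\in C\cap\operatorname{int}\operatorname{dom} f$, $k$. $f$-demiclosed: an operator $G$ defined on $\mathcal C$ is $f$-demiclosed if for every $x\in\mathcal C\cap\operatorname{int}\operatorname{dom} f$ and every sequence $(x_k)$ in $\operatorname{int}\operatorname{dom} f$ with $(Gx_k)$ in $\operatorname{int}\operatorname{dom} f$, $x_k\rightharpoonup x$ and $D_f(x_k,Gx_k)\to0$ imply $x\in\operatorname{Fix}G$. *)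

(* Defs.v *)
(* A real Hilbert space is rendered as a complete
   normed module H over a realType R together with an inner product ip
   inducing the norm. *)
From HB Require Import structures.
From mathcomp Require Import all_boot all_order all_algebra.
From mathcomp Require Import all_classical all_reals all_analysis.
Set Implicit Arguments. Unset Strict Implicit. Unset Printing Implicit Defensive.
Import Order.TTheory GRing.Theory Num.Theory.
Import numFieldNormedType.Exports.
Local Open Scope classical_set_scope.
Local Open Scope ring_scope.

Section Defs.
Variables (R : realType) (H : completeNormedModType R) (ip : H -> H -> R).

Definition inner_product : Prop :=
  [/\ (forall x y, ip x y = ip y x),
      (forall a x y z, ip (a *: x + y) z = a * ip x z + ip y z) &
      (forall x, ip x x = `|x| ^+ 2)].

Local Open Scope ereal_scope.
Variable f : H -> \bar R.

Definition dom : set H := [set x | f x < +oo].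
Definition idom : set H := interior dom.

Definition proper_fun : Prop := (forall x, f x != -oo) /\ (exists x, f x < +oo).

Definition convex_fun : Prop := forall (x y : H) (t : R), (0 < t < 1)%R ->
  f (t *: x + (1 - t) *: y)%R <= t%:E * f x + (1 - t)%:E * f y.

Definition cvx_set (C : set H) : Prop := forall (x y : H) (t : R),
  C x -> C y -> (0 <= t <= 1)%R -> C (t *: x + (1 - t) *: y)%R.

Definition strictly_convex_on (C : set H) : Prop := forall (x y : H) (t : R),
  C x -> C y -> x != y -> (0 < t < 1)%R ->
  f (t *: x + (1 - t) *: y)%R < t%:E * f x + (1 - t)%:E * f y.

Definition is_gateaux_grad (x g : H) : Prop :=
  f x \is a fin_num /\
  forall d : H, ((fun t : R => ((fine (f (x + t *: d)%R) - fine (f x)) / t)%R)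
                   @ (0%R : R)^' --> ip g d).

Definition gateaux_diff_at (x : H) : Prop := exists g, is_gateaux_grad x g.

(* the gradient (well defined where f is Gateaux differentiable) *)
Definition grad (x : H) : H := xget 0%R (is_gateaux_grad x).

Definition subdiff (x u : H) : Prop :=
  f x \is a fin_num /\ forall y, f x + (ip u (y - x)%R)%:E <= f y.

Definition dom_subdiff : set H := [set x | exists u, subdiff x u].

Definition essentially_smooth : Prop :=
  [/\ dom_subdiff = idom, idom !=set0,
      (forall x, idom x -> gateaux_diff_at x) &
      (forall (xk : nat -> H) (x : H), (forall k, idom (xk k)) ->
         xk @ \oo --> x -> closure dom x -> ~ idom x ->
         (fun k => `|grad (xk k)|%R) @ \oo --> +oo%R)].

Definition essentially_strictly_convex : Prop :=
  (forall u : H, (exists x, subdiff x u) ->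
     exists r : R, (0 < r)%R /\ exists M : R, forall v x,
       (`|v - u| < r)%R -> subdiff x v -> (`|x| <= M)%R) /\
  (forall C : set H, cvx_set C -> C `<=` dom_subdiff -> strictly_convex_on C).

Definition legendre : Prop := essentially_smooth /\ essentially_strictly_convex.

Definition bregman (x y : H) : \bar R :=
  if `[< idom y >] then f x - f y - (ip (grad y) (x - y)%R)%:E else +oo.

Definition Fix (T : H -> H) : set H := [set x | T x = x].

Definition aff (A : set H) : set H :=
  [set v | exists (n : nat) (s : 'I_n -> H) (l : 'I_n -> R),
     [/\ forall i, A (s i), (\sum_(i < n) l i)%R = 1%R &
         v = (\sum_(i < n) l i *: s i)%R]].

Definition bregman_isometric (T : H -> H) : Prop :=
  forall x y, dom x -> idom y ->
    [/\ dom (T x), idom (T y) & bregman (T x) (T y) = bregman x y].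

Variables (m : nat) (T : 'I_m -> H -> H).

Definition Sset (x : H) : set H := [set x] `|` [set T i x | i in [set: 'I_m]].

Definition CC (y : H) : set H :=
  [set v | aff (Sset y) v /\ idom v /\
           forall i, bregman y v = bregman (T i y) v].

(* the point-valued circumcenter map, identifying a singleton with its
   element (an arbitrary choice otherwise) *)
Definition CCpt (y : H) : H := xget y (CC y).

Definition bproj (C : set H) (y : H) : set H :=
  [set u | C u /\ dom u /\ forall c, C c -> bregman u y <= bregman c y].

Definition FixAll : set H := \bigcap_(i in [set: 'I_m]) Fix (T i).

Definition forward_bregman_monotone (C : set H) (xk : nat -> H) : Prop :=
  [/\ (C `&` idom) !=set0, (forall k, idom (xk k)) &
      forall c k, C c -> idom c -> bregman (xk k.+1) c <= bregman (xk k) c].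

Definition weak_cvg (u : nat -> H) (x : H) : Prop :=
  forall h, (fun k => ip (u k) h) @ \oo --> ip x h.

Definition weak_cluster (u : nat -> H) (p : H) : Prop :=
  exists phi : nat -> nat, (forall k, (phi k < phi k.+1)%N) /\
                            weak_cvg (u \o phi) p.

Definition f_demiclosed (G : H -> H) (C : set H) : Prop :=
  forall (x : H) (xk : nat -> H), C x -> idom x ->
    (forall k, idom (xk k)) -> (forall k, idom (G (xk k))) ->
    weak_cvg xk x -> (fun k => bregman (xk k) (G (xk k))) @ \oo --> 0 ->
    Fix G x.

End Defs.

(* Main.v *)
(* For z in F the isometries give D(T_i x, z) = D(x, z).  If p minimizes D(., z)
   over the finite-dimensional affine space A = aff(S(y)), then p is interior
   because f is essentially smooth, so grad f(p) - grad f(z) is orthogonal to the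
   direction of A and D(x, z) = D(x, p) + D(p, z) for all x in A.  Applied to the
   points of S(y), all at the same distance from z, this says that p is
   equidistant from S(y), that is, p is the circumcenter.  The same identity makes
   D(x_k, z) decrease by exactly D(x_k, x_{k+1}), whence (iv) and (v).  For (vi),
   sublevel sets of D(., z) are bounded because the inverse subdifferential is
   locally bounded, weak cluster points lie in F by demiclosedness, and there is
   only one of them because D(x_k, p) - D(x_k, q) converges for p, q in F. *)
Require Import Defs.
From HB Require Import structures.
From mathcomp Require Import all_boot all_order all_algebra.
From mathcomp Require Import all_classical all_reals all_analysis.
From mathcomp Require Import ring lra.
Set Implicit Arguments. Unset Strict Implicit. Unset Printing Implicit Defensive.
Import Order.TTheory GRing.Theory Num.Theory.
Import numFieldNormedType.Exports.
Local Open Scope classical_set_scope.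
Local Open Scope ring_scope.

(** * Elementary facts on small slopes and subsequences *)

(** Serves first-order optimality conditions: minimality along a segment, divided by the parameter
    [t], leaves a linear term [a] and a remainder [t * b] that vanishes as [t] tends to 0. *)
Lemma ge0_of_small_slope (R : realFieldType) (a b : R) :
  (forall t, 0 < t <= 1 -> 0 <= a + t * b) -> 0 <= a.
Proof.
move=> ab; case: (leP 0 a) => // a0.
(* If [a < 0], this choice of [t] gives [t * b <= - a / 2], hence [a + t * b <= a / 2 < 0]. *)
have := ab (Num.min 1 (- a / (2 * (`|b| + 1)))).
have b1 : 0 < `|b| + 1 by apply: ltr_wpDl.
set q := - a / _; have q0 : 0 < q by rewrite divr_gt0 ?oppr_gt0 ?mulr_gt0.
rewrite lt_min ltr01 q0 ge_min lexx /= => /(_ isT) h.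
set t := Num.min 1 q in h.
have t0 : 0 < t by rewrite /t lt_min ltr01 q0.
have tq : t <= q by rewrite /t ge_min lexx orbT.
have : t * b <= q * (`|b| + 1).
  apply: le_trans (_ : t * (`|b| + 1) <= _); last by rewrite ler_wpM2r // ltW.
  rewrite ler_wpM2l ?(ltW t0) //; apply: le_trans (ler_norm b) _.
  by rewrite lerDl.
have -> : q * (`|b| + 1) = - a / 2 by rewrite /q; field; rewrite gt_eqF.
lra.
Qed.

Lemma subseq_ge (phi : nat -> nat) n : (forall k, (phi k < phi k.+1)%N) -> (n <= phi n)%N.
Proof. by move=> phiS; elim: n => // n IH; exact: leq_ltn_trans IH (phiS n). Qed.

Lemma cvg_subseq {T : topologicalType} (u : nat -> T) (phi : nat -> nat) (l : T) :
  (forall k, (phi k < phi k.+1)%N) -> u @ \oo --> l -> u \o phi @ \oo --> l.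
Proof.
move=> phiS ul; apply: cvg_comp ul => A [N _ NA]; exists N => // n /= Nn.
by apply: NA => /=; exact: leq_trans Nn (subseq_ge n phiS).
Qed.

(** * Hilbert spaces *)

Section InnerProduct.
Variables (R : realType) (H : completeNormedModType R) (ip : H -> H -> R).
Hypothesis ipP : inner_product ip.

Lemma ipC x y : ip x y = ip y x. Proof. by case: ipP. Qed.
Lemma ip_sqr x : ip x x = `|x| ^+ 2. Proof. by case: ipP. Qed.
Lemma ip_ge0 x : 0 <= ip x x. Proof. by rewrite ip_sqr sqr_ge0. Qed.
Lemma ipDl x y z : ip (x + y) z = ip x z + ip y z.
Proof. by case: ipP => _ /(_ 1 x y z); rewrite scale1r mul1r. Qed.
Lemma ip0l z : ip 0 z = 0.
Proof. by have := ipDl 0 0 z; rewrite addr0 => /eqP; rewrite -subr_eq subrr => /eqP. Qed.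
Lemma ipZl a x z : ip (a *: x) z = a * ip x z.
Proof. by case: ipP => _ /(_ a x 0 z); rewrite !addr0 ip0l addr0. Qed.
Lemma ipNl x z : ip (- x) z = - ip x z.
Proof. by rewrite -scaleN1r ipZl mulN1r. Qed.
Lemma ipDr x y z : ip x (y + z) = ip x y + ip x z.
Proof. by rewrite ipC ipDl !(ipC _ x). Qed.
Lemma ip0r z : ip z 0 = 0. Proof. by rewrite ipC ip0l. Qed.
Lemma ipZr a x z : ip x (a *: z) = a * ip x z.
Proof. by rewrite ipC ipZl ipC. Qed.
Lemma ipNr x z : ip x (- z) = - ip x z.
Proof. by rewrite ipC ipNl ipC. Qed.
Definition ipE := (ipDl, ipDr, ipZl, ipZr, ipNl, ipNr, ip0l, ip0r).

Lemma ip_eq0 x : ip x x = 0 -> x = 0.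
Proof. by rewrite ip_sqr => /eqP; rewrite sqrf_eq0 normr_eq0 => /eqP. Qed.

Lemma ip_inj x y : (forall w, ip x w = ip y w) -> x = y.
Proof.
move=> xy; apply/eqP; rewrite -subr_eq0; apply/eqP/ip_eq0.
by rewrite ipDl ipNl xy subrr.
Qed.

End InnerProduct.

(* Linear identities between vectors become ring identities after pairing with
   an arbitrary vector. *)
Ltac vec_eq := match goal with
  | ipP : inner_product _ |- _ => apply: (ip_inj ipP) => ?; rewrite !(ipE ipP); ring
  end.

Section Hilbert.
Variables (R : realType) (H : completeNormedModType R) (ip : H -> H -> R).
Hypothesis ipP : inner_product ip.

Lemma cauchy_schwarz x y : `|ip x y| <= `|x| * `|y|.
Proof.
rewrite -ler_sqr ?nnegrE ?mulr_ge0 // real_normK ?num_real //.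
rewrite exprMn -!(ip_sqr ipP).
have [y0|y0] := eqVneq (ip y y) 0; first by rewrite (ip_eq0 ipP y0) !(ipE ipP) expr2 !mulr0.
have yy : 0 < ip y y by rewrite lt_neqAle eq_sym y0 (ip_ge0 ipP).
have := (ip_ge0 ipP) (ip y y *: x - ip x y *: y).
have -> : ip (ip y y *: x - ip x y *: y) (ip y y *: x - ip x y *: y) =
  ip y y * (ip x x * ip y y - ip x y ^+ 2) by rewrite !(ipE ipP) (ipC ipP y x); ring.
by rewrite pmulr_rge0 // subr_ge0.
Qed.

Lemma ip_cvg {T : Type} (F : set_system T) {FF : Filter F} (u : T -> H) x h :
  u @ F --> x -> (fun k => ip (u k) h) @ F --> ip x h.
Proof.
move=> ux; apply/cvgrPdist_lt => e e0.
have h1 : 0 < `|h| + 1 by apply: ltr_wpDl.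
move/cvgrPdist_lt : ux => /(_ _ (divr_gt0 e0 h1)).
apply: filterS => k; rewrite ltr_pdivlMr // => lk.
rewrite -(ipNl ipP) -(ipDl ipP); apply: le_lt_trans (cauchy_schwarz _ _) _.
by apply: le_lt_trans lk; rewrite ler_wpM2l // lerDl.
Qed.

Lemma sqr_dist_cvg {T : Type} (F : set_system T) {FF : Filter F} (u : T -> H) x h :
  u @ F --> x -> (fun k => `|u k - h| ^+ 2) @ F --> `|x - h| ^+ 2.
Proof.
move=> ux; have dx : (fun k => `|u k - h|) @ F --> `|x - h|.
  by apply: cvg_norm; apply: cvgB => //; exact: cvg_cst.
exact: cvgM.
Qed.

(** The midpoint inequality makes every minimizing sequence Cauchy; the last hypothesis, a
    sequential form of lower semicontinuity, makes its limit a minimizer. It yields projections,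
    Riesz representation and proximal points. *)
Lemma strongly_convex_min (D : set H) (g : H -> R) (c kap : R) :
  D !=set0 -> 0 < kap -> (forall x, D x -> c <= g x) ->
  (forall x y, D x -> D y -> D (2^-1 *: (x + y)) /\
     g (2^-1 *: (x + y)) + kap * `|x - y| ^+ 2 <= (g x + g y) / 2) ->
  (forall u x l, (forall n : nat, D (u n)) -> u @ \oo --> x -> g \o u @ \oo --> l ->
     D x /\ g x <= l) ->
  exists2 x, D x & forall y, D y -> g x <= g y.
Proof.
move=> D0 kap0 cg mid clo.
pose i := inf (g @` D).
have hi : has_inf (g @` D).
  split; first by case: D0 => x Dx; exists (g x), x.
  by exists c => _ [x Dx <-]; exact: cg.
have ig x : D x -> i <= g x.
  by move=> Dx; apply: ge_inf; [case: hi|exists x].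
have /choice [u uP] : forall n : nat, exists x, D x /\ g x < i + n.+1%:R^-1.
  move=> n; have n0 : 0 < n.+1%:R^-1 :> R by rewrite invr_gt0 ltr0n.
  by have [_ [x Dx <-] xi] := inf_adherent n0 hi; exists x.
have ucv : cvg (u @ \oo).
  apply/cauchy_cvgP; apply: cauchy_exP => e e0.
  have ke : 0 < kap * e ^+ 2 by rewrite mulr_gt0 // exprn_gt0.
  (* For [n >= N] the midpoint value is at least [i], so [kap * |u N - u n|^2] is below the mean of
     the two errors [1/(N+1)] and [1/(n+1)], hence below [kap * e^2]. *)
  have [N _ /(_ N (leqnn N)) /= Ne] := near_infty_natSinv_lt (PosNum ke).
  exists (u N); exists N => // n /= Nn.
  rewrite -ball_normE /=; rewrite -ltr_sqr ?nnegrE ?(ltW e0)//.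
  rewrite -(ltr_pM2l kap0); apply: le_lt_trans Ne.
  have [DN gN] := uP N; have [Dn gn] := uP n.
  have [Dm gm] := mid _ _ DN Dn; have := ig _ Dm.
  have : (n.+1%:R^-1 : R) <= N.+1%:R^-1 by rewrite lef_pV2 ?posrE ?ltr0n// ler_nat.
  move: gm gN gn.
  move: (g (2^-1 *: _)) (g (u N)) (g (u n)) (kap * _) (n.+1%:R^-1 : R) (N.+1%:R^-1 : R).
  by move=> *; lra.
have /cvg_ex[x ux] := ucv.
have gl : g \o u @ \oo --> i.
  apply: (@squeeze_cvgr _ _ _ _ (fun=> i) (fun n => i + n.+1%:R^-1)).
  - by near=> n => /=; have [Dn /ltW ->] := uP n; rewrite ig.
  - exact: cvg_cst.
  - rewrite -[X in _ --> X]addr0; apply: cvgD; first exact: cvg_cst.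
    exact: cvg_harmonic.
have [Dx gx] := clo u x i (fun n => (uP n).1) ux gl.
by exists x => // y Dy; apply: le_trans gx (ig _ Dy).
Unshelve. all: by end_near. Qed.

Lemma parallelogram (x a b : H) :
  `|2^-1 *: (a + b) - x| ^+ 2 + 4^-1 * `|a - b| ^+ 2 =
  (`|a - x| ^+ 2 + `|b - x| ^+ 2) / 2.
Proof.
rewrite -!(ip_sqr ipP) !(ipE ipP) (ipC ipP x a) (ipC ipP x b) (ipC ipP b a); lra.
Qed.

Lemma midpointE (a b : H) : 2^-1 *: (a + b) = 2^-1 *: a + (1 - 2^-1) *: b.
Proof. by rewrite scalerDr; congr (_ + _ *: _); field. Qed.

Lemma cvx_proj (C : set H) x : cvx_set C -> closed C -> C !=set0 ->
  exists2 p, C p & forall w, C w -> ip (w - p) (x - p) <= 0.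
Proof.
move=> cC clC C0.
have [||||p Cp pmin] := @strongly_convex_min C (fun w => `|w - x| ^+ 2) 0 (4^-1) C0.
- by [].
- by move=> w _; rewrite sqr_ge0.
- move=> a b Ca Cb; split; last by rewrite parallelogram.
  by rewrite midpointE; apply: cC => //; lra.
- move=> u z l Cu uz ul; split; first exact: (closed_cvg _ clC (nearW _ Cu) _ uz).
  have uz2 : (fun k => `|u k - x| ^+ 2) @ \oo --> `|z - x| ^+ 2 by exact: sqr_dist_cvg.
  by rewrite (cvg_unique _ ul uz2).
exists p => // w Cw.
(* Moving from [p] to [p + t (w - p)] changes the squared distance to [x] by [t] times this quantity
   plus [t^2 |w - p|^2]. *)
suff : 0 <= 2 * ip (w - p) (p - x).
  by rewrite -(opprB x p) (ipNr ipP); lra.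
apply: (@ge0_of_small_slope _ _ (ip (w - p) (w - p))) => t /andP[t0 t1].
have := pmin _ (cC w p t Cw Cp _); rewrite (ltW t0) t1 => /(_ isT).
have -> : t *: w + (1 - t) *: p - x = (p - x) + t *: (w - p).
  by vec_eq.
rewrite -!(ip_sqr ipP); move: (p - x) (w - p) => a b.
rewrite !(ipE ipP) (ipC ipP a b) => h.
rewrite -(@pmulr_rge0 _ t) //; lra.
Qed.

(** * Closed subspaces, finite spans and affine hulls *)

Definition linear_subspace (W : set H) :=
  W 0 /\ forall a x y, W x -> W y -> W (a *: x + y).

Lemma subspace_cvx W : linear_subspace W -> cvx_set W.
Proof.
by move=> [W0 Wl] x y t Wx Wy _; apply: (Wl) => //; rewrite -[_ *: y]addr0; exact: Wl.
Qed.

Lemma subspaceZ W a x : linear_subspace W -> W x -> W (a *: x).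
Proof. by move=> [W0 Wl] Wx; rewrite -[_ *: _]addr0; exact: Wl. Qed.

Lemma subspaceB W x y : linear_subspace W -> W x -> W y -> W (x - y).
Proof. by move=> [W0 Wl] Wx Wy; rewrite addrC -scaleN1r; exact: Wl. Qed.

Lemma subspace_sum W n (l : 'I_n -> R) (s : 'I_n -> H) : linear_subspace W ->
  (forall i, W (s i)) -> W (\sum_(i < n) l i *: s i).
Proof.
move=> sW Ws; apply: (big_ind W); [exact: sW.1| |].
  by move=> x y Wx Wy; rewrite -[x]scale1r; exact: sW.2.
by move=> i _; exact: subspaceZ.
Qed.

Lemma orth_proj W x : linear_subspace W -> closed W ->
  exists2 p, W p & forall w, W w -> ip w (x - p) = 0.
Proof.
move=> sW cW; have [W0 Wl] := sW.
have [|p Wp pP] := cvx_proj x (subspace_cvx sW) cW; first by exists 0.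
exists p => // w Ww; apply/le_anti/andP; split.
  by have := pP _ (Wl 1 _ _ Ww Wp); rewrite scale1r addrK.
by have := pP _ (Wl (-1) _ _ Ww Wp); rewrite addrK scaleN1r (ipNl ipP) oppr_le0.
Qed.

(** Replacing [v] by its component [e] orthogonal to [W] does not change the sum of [W] and the
    line. The coefficient along [e] is then the continuous function [k], and the sum is a preimage
    of [W]. If [e = 0], the value of [k] is immaterial. *)
Lemma closed_add_line W v : linear_subspace W -> closed W ->
  closed [set x | exists t, W (x - t *: v)].
Proof.
move=> sW cW; have [q Wq] := orth_proj v sW cW.
have ve : v = q + (v - q) by rewrite addrC subrK.
move: (v - q) ve => e ve qP; pose k x := ip x e / ip e e.
have -> : [set x | exists t, W (x - t *: v)] = (fun x => x - k x *: e) @^-1` W.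
  apply/seteqP; split => x /=; last first.
    move=> Wx; exists (k x); have -> : x - k x *: v = x - k x *: e - k x *: q.
      by rewrite ve; vec_eq.
    by apply: subspaceB => //; exact: subspaceZ.
  move=> [t Wt].
  have Wte : W (x - t *: e).
    have -> : x - t *: e = t *: q + (x - t *: v) by rewrite ve; vec_eq.
    by apply: sW.2.
  suff -> : k x *: e = t *: e by [].
  have := qP _ Wte; rewrite !(ipE ipP) => /eqP; rewrite subr_eq0 => /eqP xe.
  have [e0|e0] := eqVneq (ip e e) 0; first by rewrite (ip_eq0 ipP e0) !scaler0.
  by rewrite /k xe mulfK.
apply: preimage_closed => // x _; apply: cvgB; first exact: cvg_id.
apply: cvgZ; last exact: cvg_cst.
by apply: cvgM; [apply: ip_cvg; exact: cvg_id|exact: cvg_cst].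
Qed.

Definition finspan n (v : 'I_n -> H) : set H :=
  [set x | exists l : 'I_n -> R, x = \sum_(i < n) l i *: v i].

Lemma finspan_mem n (v : 'I_n -> H) i : finspan v (v i).
Proof.
exists (fun j => (j == i)%:R); rewrite (bigD1 i) //= eqxx scale1r big1 ?addr0 //.
by move=> j /negbTE ->; rewrite scale0r.
Qed.

Lemma finspan_subspace n (v : 'I_n -> H) : linear_subspace (finspan v).
Proof.
split; first by exists (fun=> 0); rewrite big1 // => i _; rewrite scale0r.
move=> a _ _ [l ->] [k ->]; exists (fun i => a * l i + k i).
by rewrite scaler_sumr -big_split /=; apply: eq_bigr => i _; rewrite scalerDl scalerA.
Qed.

Lemma finspan_closed n (v : 'I_n -> H) : closed (finspan v).
Proof.
elim: n v => [|n IH] v.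
  have -> : finspan v = [set 0].
    apply/seteqP; split => x /=; first by case=> l ->; rewrite big_ord0.
    by move=> ->; exists (fun=> 0); rewrite big_ord0.
  exact: accessible_closed_set1 (hausdorff_accessible (@norm_hausdorff _ _)) _.
set w := fun i : 'I_n => v (widen_ord (leqnSn n) i).
have -> : finspan v = [set x | exists t, finspan w (x - t *: v ord_max)].
  apply/seteqP; split => x /=.
    move=> [l ->]; exists (l ord_max), (l \o widen_ord (leqnSn n)).
    by rewrite big_ord_recr /= addrK.
  move=> [t [l /eqP]]; rewrite subr_eq => /eqP ->.
  exists (fun i => if unlift ord_max i is Some j then l j else t).
  rewrite big_ord_recr /= unlift_none; congr (_ + _); apply: eq_bigr => i _.
  have -> : widen_ord (leqnSn n) i = lift ord_max i.
    by apply: val_inj; rewrite /= /bump leqNgt ltn_ord.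
  by rewrite liftK /w; congr (_ *: v _); apply: val_inj; rewrite /= /bump leqNgt ltn_ord.
by apply: closed_add_line; [exact: finspan_subspace|exact: IH].
Qed.

Lemma aff_Sset m (T : 'I_m -> H -> H) y :
  aff (Sset T y) = [set v | finspan (fun i => T i y - y) (v - y)].
Proof.
set W := finspan _; have sW : linear_subspace W := finspan_subspace _.
have WT i : W (T i y - y) by exact: (finspan_mem (fun i => T i y - y)).
apply/seteqP; split => v /=.
  move=> [n [s [l [sA l1 ->]]]].
  have -> : \sum_(i < n) l i *: s i - y = \sum_(i < n) l i *: (s i - y).
    under [RHS]eq_bigr do rewrite scalerBr.
    by rewrite sumrB -scaler_suml l1 scale1r.
  apply: subspace_sum => // i; case: (sA i) => [->|[j _ <-]]; last exact: WT.
  by rewrite subrr; exact: sW.1.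
move=> [l vE].
(* Index 0 carries the base point [y], whose coefficient makes the total equal to 1. *)
exists m.+1, (fun i => if unlift ord0 i is Some j then T j y else y).
exists (fun i => if unlift ord0 i is Some j then l j else 1 - \sum_(i < m) l i).
split.
- by move=> i; case: unliftP => [j _|_]; [right; exists j|left].
- rewrite big_ord_recl unlift_none [X in _ + X](eq_bigr l) ?subrK // => i _.
  by rewrite liftK.
- rewrite big_ord_recl unlift_none (eq_bigr (fun i => l i *: T i y)); last first.
    by move=> i _; rewrite liftK.
  rewrite -[v in LHS](subrK y) vE.
  have -> : \sum_(i < m) l i *: (T i y - y) =
      \sum_(i < m) l i *: T i y - (\sum_(i < m) l i) *: y.
    by rewrite scaler_suml -sumrB; apply: eq_bigr => i _; rewrite scalerBr.
  by vec_eq.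
Qed.

(** * Riesz representation and weak sequential compactness *)

Lemma ultra_bounded_cvg T (U : set_system T) (u : T -> R) c : UltraFilter U ->
  (forall k, `|u k| <= c) -> exists l : R, u @ U --> l.
Proof.
move=> UU uc.
have [|l [_ lcl]] := @segment_compact R (- c) c (u @ U) _.
  by apply: (@filterE _ U) => k /=; rewrite in_itv /= -ler_norml; exact: uc.
exists l => V lV; have [//|UV] := in_ultra_setVsetC (u @^-1` V) UU.
by have [z []] := lcl (~` V) V UV lV.
Qed.

(** The representing vector minimizes [|w|^2 - 2 L w], which is bounded below by [- M^2].
    Stationarity in the directions [h] and [- h] gives the two inequalities. *)
Lemma riesz (L : H -> R) M :
  (forall a x y, L (a *: x + y) = a * L x + L y) -> (forall x, `|L x| <= M * `|x|) ->
  exists p, forall h, L h = ip p h.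
Proof.
move=> Llin LM.
have LD x y : L (x + y) = L x + L y by rewrite -[x]scale1r Llin mul1r scale1r.
have L0 : L 0 = 0 by have := LD 0 0; rewrite addr0 => /eqP; rewrite -subr_eq subrr => /eqP.
have LZ a x : L (a *: x) = a * L x by rewrite -[_ *: _]addr0 Llin L0 addr0.
have LN x : L (- x) = - L x by rewrite -scaleN1r LZ mulN1r.
have [|||||p _ pmin] := @strongly_convex_min setT (fun w => `|w| ^+ 2 - 2 * L w)
   (- M ^+ 2) 4^-1 _.
- by exists 0.
- by [].
- move=> x _; have := sqr_ge0 (`|x| - M); have := LM x; have := ler_norm (L x).
  by rewrite sqrrB; move: (`|x|) => *; nra.
- move=> x y _ _; split=> //; have := parallelogram 0 x y; rewrite !subr0 LZ LD.
  by move=> *; lra.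
- move=> u x l _ ux ul; split=> //.
  have Lu : L \o u @ \oo --> L x.
    apply/cvgrPdist_lt => e e0; have M1 : 0 < `|M| + 1 by apply: ltr_wpDl.
    move/cvgrPdist_lt : ux => /(_ _ (divr_gt0 e0 M1)).
    apply: filterS => k; rewrite ltr_pdivlMr // => lk.
    rewrite /= -LN -LD; apply: le_lt_trans (LM _) _; apply: le_lt_trans lk.
    by rewrite mulrC ler_wpM2l // (le_trans (ler_norm M)) // lerDl.
  have nu : (fun k => `|u k - 0| ^+ 2) @ \oo --> `|x - 0| ^+ 2 by exact: sqr_dist_cvg.
  have lim : (fun w => `|w| ^+ 2 - 2 * L w) \o u @ \oo --> `|x| ^+ 2 - 2 * L x.
    apply: cvgB; last by apply: cvgM => //; exact: cvg_cst.
    by move: nu; rewrite subr0; under eq_cvg do rewrite subr0.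
  by rewrite (cvg_unique _ ul lim).
have ge h : 0 <= ip p h - L h.
  apply: (@ge0_of_small_slope _ _ (ip h h / 2)) => t /andP[t0 t1].
  have := pmin (p + t *: h) I; rewrite LD LZ -!(ip_sqr ipP) !(ipE ipP) (ipC ipP h p) => hh.
  by rewrite -(@pmulr_rge0 _ t) //; lra.
exists p => h; apply/le_anti/andP; split; first by rewrite -subr_ge0.
by have := ge (- h); rewrite (ipNr ipP) LN opprK addrC subr_ge0.
Qed.

(* The limits of [ip (u k) h] along an ultrafilter define [p] by Riesz.  A diagonal
   choice of indices gives convergence to [ip p h] for [h] among the [u j]; the [h]
   for which it holds form a closed subspace [W], and a vector orthogonal to [W]
   is orthogonal to all [u j] and to [p], hence in [W]. *)
Lemma weak_seq_compact (u : nat -> H) M : (forall k, `|u k| <= M) ->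
  exists p, weak_cluster ip u p.
Proof.
move=> uM; have M0 : 0 <= M := le_trans (normr_ge0 _) (uM 0%N).
have uh k h : `|ip (u k) h| <= M * `|h|.
  by apply: le_trans (cauchy_schwarz _ _) _; rewrite ler_wpM2r.
have [U [UU oU]] := ultraFilterLemma (F := \oo : set_system nat) _.
have /choice[L LP] : forall h, exists l : R, (fun k => ip (u k) h) @ U --> l.
  by move=> h; exact: ultra_bounded_cvg (uh ^~ h).
have [||p pL] := @riesz L M.
- move=> a x y; apply: (cvg_unique _ (LP _)) => //=.
  have -> : (fun k => ip (u k) (a *: x + y)) = (fun k => a * ip (u k) x + ip (u k) y).
    by apply/funext => k; rewrite (ipDr ipP) (ipZr ipP).
  by apply: cvgD => //; apply: cvgM => //; exact: cvg_cst.
- move=> h; have : [set` `[- (M * `|h|), M * `|h|]] (L h).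
    apply: (closed_cvg _ _ _ _ (LP h)); first exact: interval_closed.
    by apply: nearW => k /=; rewrite in_itv /= -ler_norml.
  by rewrite /= in_itv /= -ler_norml.
have /choice[pick pickP] : forall nN : nat * nat, exists k, (nN.2 <= k)%N /\
    forall j : 'I_nN.1, `|ip p (u j) - ip (u k) (u j)| < nN.1.+1%:R^-1.
  move=> [n N] /=; apply: (@filter_ex _ U _).
  apply: filterI; first by apply: oU; exact: nbhs_infty_ge.
  apply: filter_forall => j; move: (LP (u j)); rewrite pL => /cvgrPdist_lt; apply.
  by rewrite invr_gt0 ltr0n.
(* The second component of the pair demands an index beyond the preceding one, so [phi] increases
   strictly; the first sets the number of vectors [u j] tested and the precision. *)
pose phi := nat_rect (fun=> nat) (pick (0, 0)%N) (fun n r => pick (n.+1, r.+1)).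
have phiP n (j : 'I_n) : `|ip p (u j) - ip (u (phi n)) (u j)| < n.+1%:R^-1.
  by case: n j => [|n] j; [case: j|exact: (pickP (n.+1, (phi n).+1)).2].
exists p, phi; split; first by move=> k; exact: (pickP (k.+1, (phi k).+1)).1.
pose W := [set h | (fun n => ip (u (phi n)) h) @ \oo --> ip p h].
have sW : linear_subspace W.
  split; first by rewrite /W /= (ip0r ipP); under eq_cvg do rewrite (ip0r ipP); exact: cvg_cst.
  move=> a x y Wx Wy; rewrite /W /= (ipDr ipP) (ipZr ipP); under eq_cvg do rewrite (ipDr ipP) (ipZr ipP).
  by apply: cvgD => //; apply: cvgM => //; exact: cvg_cst.
have cW : closed W.
  move=> h hW; apply/cvgrPdist_lt => e e0.
  have Mp : 0 < 2 * (M + `|p| + 1) by rewrite mulr_gt0 // ltr_wpDl // addr_ge0.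
  have [w [Ww]] := hW _ (nbhsx_ballx h _ (divr_gt0 e0 Mp)).
  rewrite -ball_normE /= ltr_pdivlMr // => hw.
  have e2 : 0 < e / 2 by rewrite divr_gt0.
  move/cvgrPdist_lt : Ww => /(_ _ e2); apply: filterS => n pn.
  have -> : ip p h - ip (u (phi n)) h =
     (ip p w - ip (u (phi n)) w) + (ip p (h - w) - ip (u (phi n)) (h - w)).
    by rewrite !(ipE ipP); ring.
  apply: le_lt_trans (ler_normD _ _) _.
  have := ler_normB (ip p (h - w)) (ip (u (phi n)) (h - w)).
  have := cauchy_schwarz p (h - w); have := uh (phi n) (h - w).
  have := normr_ge0 (h - w); lra.
have Wu j : W (u j).
  apply/cvgrPdist_lt => e e0; near=> n.
  have jn : (j < n)%N by near: n; exact: nbhs_infty_gt.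
  apply: lt_trans (phiP n (Ordinal jn)) _.
  by near: n; exact: (near_infty_natSinv_lt (PosNum e0)).
move=> h; have [w Ww wP] := orth_proj h sW cW.
suff We : W (h - w) by have := sW.2 1 _ _ We Ww; rewrite scale1r subrK.
have e0 k : ip (u k) (h - w) = 0 by exact: wP.
have pe : ip p (h - w) = 0.
  rewrite -pL; apply: (cvg_unique _ (LP _)) => //.
  by rewrite /= (funext e0); exact: cvg_cst.
by rewrite /W /= pe; under eq_cvg do rewrite e0; exact: cvg_cst.
Unshelve. all: by end_near. Qed.

(** With [q] the projection of [p] on [C], the inequality [ip (u k - q) (p - q) <= 0] passes to the
    weak limit and becomes [|p - q|^2 <= 0]. *)
Lemma cvx_weak_closed (C : set H) (u : nat -> H) p : cvx_set C -> closed C ->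
  (\forall k \near \oo, C (u k)) -> weak_cvg ip u p -> C p.
Proof.
move=> cC clC Cu up.
have [|q Cq qP] := cvx_proj p cC clC; first by have [k Ck] := filter_ex Cu; exists (u k).
have -> //: p = q; apply/eqP; rewrite -subr_eq0; apply/eqP/(ip_eq0 ipP)/le_anti.
rewrite (ip_ge0 ipP) andbT.
have : (fun k => ip (u k - q) (p - q)) @ \oo --> ip (p - q) (p - q).
  rewrite (ipDl ipP); under eq_cvg do rewrite (ipDl ipP).
  by apply: cvgD; [exact: up|exact: cvg_cst].
move=> lim; rewrite -(cvg_lim _ lim) //; apply: limr_le.
  by apply/cvg_ex; eexists; exact: lim.
by apply: filterS Cu => k; exact: qP.
Qed.

(** Otherwise, for some [h], a subsequence [psi] keeps [ip (u _) h] at distance at least [e] from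
    [ip p h]. Weak compactness extracts from it a cluster point, which must be [p]: a
    contradiction. *)
Lemma weak_cvg_unique_cluster (u : nat -> H) M p : (forall k, `|u k| <= M) ->
  (forall q, weak_cluster ip u q -> q = p) -> weak_cvg ip u p.
Proof.
move=> uM up h; apply/cvgrPdist_lt => e e0; apply: contrapT => nh.
have /choice[pick pickP] : forall N : nat, exists n, (N <= n)%N /\
    e <= `|ip p h - ip (u n) h|.
  move=> N; apply: contrapT => nN; apply: nh; exists N => // n /= Nn.
  by rewrite ltNge; apply/negP => en; apply: nN; exists n.
pose psi := nat_rect (fun=> nat) (pick 0%N) (fun _ r => pick r.+1).
have psiS k : (psi k < psi k.+1)%N by exact: (pickP (psi k).+1).1.
have psi_mono : {homo psi : i j / (i < j)%N} by apply: homo_ltn => //; exact: ltn_trans.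
have psiP k : e <= `|ip p h - ip (u (psi k)) h|.
  by case: k => [|k]; [exact: (pickP 0%N).2|exact: (pickP (psi k).+1).2].
have [q [phi [phiS uq]]] := @weak_seq_compact (u \o psi) M (fun k => uM _).
have qp : q = p by apply: up; exists (psi \o phi); split=> // k; exact: psi_mono.
have lim : (fun k => ip (u (psi (phi k))) h) @ \oo --> ip p h by rewrite -qp; exact: uq.
move/cvgrPdist_lt : lim => /(_ _ e0) /filter_ex[k].
by rewrite ltNge psiP.
Qed.

End Hilbert.

(** * Convex functions and Bregman distances *)

Section ConvexFunction.
Variables (R : realType) (H : completeNormedModType R) (f : H -> \bar R).
Hypotheses (fproper : proper_fun f) (flsc : lower_semicontinuous f).
Hypothesis fconvex : convex_fun f.

Local Notation fr x := (fine (f x)).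

Lemma dom_fin x : dom f x -> f x = (fr x)%:E.
Proof.
by move=> dx; rewrite fineK // fin_numElt dx ltNye fproper.1.
Qed.

Lemma notdom x : ~ dom f x -> f x = +oo%E.
Proof. by rewrite /dom /= ltey => /negP; rewrite negbK => /eqP. Qed.

Lemma idom_dom x : idom f x -> dom f x. Proof. exact: interior_subset. Qed.

Lemma dom_convex x y t : dom f x -> dom f y -> 0 <= t <= 1 ->
  dom f (t *: x + (1 - t) *: y) /\
  fr (t *: x + (1 - t) *: y) <= t * fr x + (1 - t) * fr y.
Proof.
move=> dx dy /andP[]; rewrite le_eqVlt => /predU1P[<- _|t0].
  by rewrite scale0r add0r subr0 scale1r mul0r add0r mul1r.
rewrite le_eqVlt => /predU1P[->|t1].
  by rewrite subrr scale1r scale0r addr0 mul0r addr0 mul1r.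
have := fconvex x y (t := t); rewrite t0 t1 => /(_ isT).
rewrite (dom_fin dx) (dom_fin dy) -!EFinM -EFinD => h.
have d : dom f (t *: x + (1 - t) *: y) by apply: le_lt_trans h _; exact: ltry.
by split=> //; move: h; rewrite (dom_fin d) lee_fin.
Qed.

Lemma idom_segment x y t : idom f x -> dom f y -> 0 < t <= 1 ->
  idom f (t *: x + (1 - t) *: y).
Proof.
move=> /nbhs_ballP[r /= r0 rx] dy /andP[t0 t1].
apply/nbhs_ballP; exists (t * r) => /=; first exact: mulr_gt0.
move=> w; rewrite -ball_normE /= => wm.
(* The map sending [v] to [t v + (1 - t) y] carries the ball of radius [r] about [x] onto the ball
   of radius [t * r] about the combination. *)
have -> : w = t *: (x + t^-1 *: (w - (t *: x + (1 - t) *: y))) + (1 - t) *: y.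
  rewrite scalerDr scalerA divff ?gt_eqF // scale1r addrAC addrC subrK //.
apply: (dom_convex _ dy _).1; last by rewrite (ltW t0).
apply: rx; rewrite -ball_normE /= opprD addrA subrr add0r normrN normrZ.
by rewrite gtr0_norm ?invr_gt0 // -ltr_pdivlMl ?invr_gt0 // invrK distrC.
Qed.

Lemma idom_cvx : cvx_set (idom f).
Proof.
move=> x y t ix iy /andP[]; rewrite le_eqVlt => /predU1P[<- _|t0 t1].
  by rewrite scale0r add0r subr0 scale1r.
by apply: idom_segment; rewrite ?t0 //; exact: idom_dom.
Qed.

Lemma lsc_seq (u : nat -> H) x l : (forall n, dom f (u n)) -> u @ \oo --> x ->
  (fun n => fr (u n)) @ \oo --> l -> dom f x /\ fr x <= l.
Proof.
move=> du ux ul.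
have fxl : (f x <= l%:E)%E.
  rewrite leNgt; apply/negP => lfx.
  have [a la afx] : exists2 a, l < a & (a%:E < f x)%E.
    case: (f x) lfx => [r| |] //.
      rewrite lte_fin => lr; exists ((l + r) / 2); rewrite ?lte_fin; lra.
    by move=> _; exists (l + 1); rewrite ?ltry // ltrDl.
  have [V Vx Va] := flsc afx.
  suff : a <= l by rewrite leNgt la.
  rewrite -(cvg_lim _ ul) //; apply: limr_ge; first by apply/cvg_ex; exists l.
  have : \forall n \near \oo, V (u n) by exact: ux.
  by apply: filterS => n /Va; rewrite (dom_fin (du n)) lte_fin => /ltW.
have dx : dom f x by apply: le_lt_trans fxl _; exact: ltry.
by split=> //; move: fxl; rewrite (dom_fin dx) lee_fin.
Qed.

(* The sublevel sets [f <= n] are closed and cover the domain, so by Baire one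
   of them has interior; convexity then transports the bound to any interior
   point. *)
Lemma idom_locally_bounded y : idom f y ->
  exists2 r, 0 < r & exists M, forall w, `|w - y| < r -> dom f w /\ fr w <= M.
Proof.
move=> iy.
have [n] : exists n : nat, ~ dense [set x | (n%:R%:E < f x)%E].
  apply: contrapT => /forallNP nd.
  have [|||x [ix xn]] := @Baire R H (fun n => [set x | (n%:R%:E < f x)%E]) _ (idom f).
  - move=> n; split; first exact: (lower_semicontinuousP f).1.
    exact: (contrapT (nd n)).
  - by exists y.
  - exact: open_interior.
  have /= := xn (Num.bound `|fr x|) I; rewrite (dom_fin (idom_dom ix)) lte_fin => h.
  by have := archi_boundP (normr_ge0 (fr x)); have := ler_norm (fr x); lra.
move=> /existsNP[ O /not_implyP[ [x0 Ox0] /not_implyP[oO nO] ] ].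
have /nbhs_ballP[r0 /= r00 Or0] : nbhs x0 O by exact: open_nbhs_nbhs.
have fn w : ball x0 r0 w -> dom f w /\ fr w <= n%:R.
  move=> /Or0 Ow; have h : (f w <= n%:R%:E)%E.
    by rewrite leNgt; apply/negP => nw; apply: nO; exists w.
  have dw : dom f w by apply: le_lt_trans h _; exact: ltry.
  by split=> //; move: h; rewrite (dom_fin dw) lee_fin.
have /nbhs_ballP[s /= s0 ys] := iy.
have y1 : 0 < `|y - x0| + 1 by apply: ltr_wpDl.
(* Prolonging the segment from [x0] to [y] slightly gives [x1], still in the domain. Then [y] is the
   combination of [x0] and [x1] with weight [la] on [x0], and the ball about [x0] shrinks by the
   factor [la] to a ball about [y]. *)
pose de := s / (`|y - x0| + 1); have de0 : 0 < de by exact: divr_gt0.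
pose x1 := y + de *: (y - x0).
have dx1 : dom f x1.
  apply: ys; rewrite -ball_normE /= /x1 opprD addrA subrr add0r normrN normrZ.
  by rewrite gtr0_norm // /de mulrAC -mulrA gtr_pMr // ltr_pdivrMr // mul1r ltrDl.
pose la := de / (1 + de).
have la0 : 0 < la by rewrite divr_gt0 // addr_gt0.
have la1 : la <= 1 by rewrite ler_pdivrMr ?addr_gt0 // mul1r lerDr.
exists (la * r0); first exact: mulr_gt0.
exists (la * n%:R + (1 - la) * fr x1) => w wy.
have yE : y = la *: x0 + (1 - la) *: x1.
  have l1 : (1 - la) * (1 + de) = 1.
    by rewrite /la; field; rewrite gt_eqF // addr_gt0.
  have l2 : (1 - la) * de = la by rewrite /la; field; rewrite gt_eqF // addr_gt0.
  rewrite /x1 scalerDr scalerA l2 scalerBr [_ *: y + _]addrA.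
  have l3 : 1 - la + la = 1 by ring.
  by rewrite -scalerDl l3 scale1r addrCA subrr addr0.
pose v := x0 + la^-1 *: (w - y).
have [|dv fv] := fn v.
  rewrite -ball_normE /= /v opprD addrA subrr add0r normrN normrZ.
  by rewrite gtr0_norm ?invr_gt0 // ltr_pdivrMl.
have -> : w = la *: v + (1 - la) *: x1.
  rewrite /v scalerDr scalerA divff ?gt_eqF // scale1r.
  by rewrite addrAC -yE addrC subrK.
have [|d b] := dom_convex dv dx1 (t := la); first by rewrite ltW.
by split=> //; apply: le_trans b _; rewrite lerD2r ler_wpM2l // ltW.
Qed.

End ConvexFunction.

(** * Bregman distances of a Legendre function *)

Section Bregman.
Variables (R : realType) (H : completeNormedModType R) (ip : H -> H -> R).
Variable f : H -> \bar R.
Hypotheses (ipP : inner_product ip) (fproper : proper_fun f).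
Hypotheses (flsc : lower_semicontinuous f) (fconvex : convex_fun f).
Hypothesis flegendre : legendre ip f.

Local Notation fr x := (fine (f x)).
Local Notation grad := (grad ip f).

(** Real-valued counterpart of [bregman], so that identities and limits can be handled in [R]; the
    two agree for [x] in the domain and [y] in its interior. *)
Definition rbregman x y : R := fr x - fr y - ip (grad y) (x - y).
Local Notation d := rbregman.

Lemma bregmanE x y : dom f x -> idom f y -> bregman ip f x y = (d x y)%:E.
Proof.
move=> dx iy; rewrite /bregman asboolT // (dom_fin fproper dx).
by rewrite (dom_fin fproper (idom_dom iy)) -!EFinB.
Qed.

Lemma bregman_notdom x y : ~ dom f x -> bregman ip f x y = +oo%E.
Proof.
move=> dx; rewrite /bregman; case: asboolP => // iy.
by rewrite (notdom dx) (dom_fin fproper (idom_dom iy)).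
Qed.

Lemma gradP y : idom f y -> is_gateaux_grad ip f y (grad y).
Proof. by move=> iy; case: flegendre => -[_ _ /(_ _ iy) h _] _; exact: xgetPex. Qed.

Lemma harmonic_dnbhs : (fun n => n.+1%:R^-1 : R) @ \oo --> (0 : R)^'.
Proof.
move=> A /nbhs_ballP[e /= e0 eA].
suff : \forall n \near \oo, A (n.+1%:R^-1) by [].
near=> n; apply: eA; last first.
  by rewrite invr_eq0 pnatr_eq0.
rewrite -ball_normE /= sub0r normrN gtr0_norm ?invr_gt0 ?ltr0n //.
by near: n; exact: (near_infty_natSinv_lt (PosNum e0)).
Unshelve. all: by end_near. Qed.

Lemma grad_cvg y w : idom f y ->
  (fun n => (fr (y + n.+1%:R^-1 *: w) - fr y) / n.+1%:R^-1) @ \oo --> ip (grad y) w.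
Proof.
by move=> /gradP[_ /(_ w) h]; apply: cvg_comp h; exact: harmonic_dnbhs.
Qed.

Lemma idom_near y w : idom f y -> \forall n \near \oo, dom f (y + n.+1%:R^-1 *: w).
Proof.
move=> iy; suff h : (fun n => y + n.+1%:R^-1 *: w) @ \oo --> y by exact: h.
rewrite -[X in _ --> X]addr0 -[X in _ --> _ + X](scale0r w).
apply: cvgD; first exact: cvg_cst.
by apply: cvgZ; [exact: cvg_harmonic|exact: cvg_cst].
Qed.

(** One-sided first-order condition: the difference quotients at steps [1/(n+1)] are eventually at
    least [c], and so is their limit. *)
Lemma grad_ge y w c : idom f y ->
  (forall t, 0 < t <= 1 -> dom f (y + t *: w) -> fr y + t * c <= fr (y + t *: w)) ->
  c <= ip (grad y) w.
Proof.
move=> iy h; have lim := grad_cvg (w := w) iy.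
rewrite -(cvg_lim _ lim) //; apply: limr_ge; first by apply/cvg_ex; eexists; exact: lim.
apply: filterS (idom_near w iy) => n dn.
have n0 : 0 < n.+1%:R^-1 :> R by rewrite invr_gt0 ltr0n.
rewrite ler_pdivlMr // lerBrDl mulrC h // n0 invf_le1 ?ltr0n //.
by rewrite ler1n.
Qed.

(** By convexity the difference quotients at [y] in the direction [x - y] never exceed
    [f x - f y]. *)
Lemma bregman_ge0 x y : dom f x -> idom f y -> 0 <= d x y.
Proof.
move=> dx iy; suff : fr y - fr x <= ip (grad y) (y - x).
  by rewrite -(opprB x y) (ipNr ipP) /rbregman; lra.
rewrite -(opprB x y) (ipNr ipP) lerNr opprB.
have lim := grad_cvg (w := x - y) iy.
rewrite -(cvg_lim _ lim) //; apply: limr_le; first by apply/cvg_ex; eexists; exact: lim.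
near=> n; have n0 : 0 < n.+1%:R^-1 :> R by rewrite invr_gt0 ltr0n.
have n1 : n.+1%:R^-1 <= 1 :> R by rewrite invf_le1 ?ltr0n // ler1n.
move: (n.+1%:R^-1 : R) n0 n1 => t t0 t1; rewrite ler_pdivrMr //.
have -> : y + t *: (x - y) = t *: x + (1 - t) *: y by vec_eq.
have [|_] := dom_convex fproper fconvex dx (idom_dom iy) (t := t).
  by rewrite t1 ltW.
lra.
Unshelve. all: by end_near. Qed.

Lemma grad_subdiff y : idom f y -> subdiff ip f y (grad y).
Proof.
move=> iy; have fy := dom_fin fproper (idom_dom iy); split; first by rewrite fy.
move=> x; have [dx|ndx] := pselect (dom f x); last by rewrite (notdom ndx) leey.
rewrite (dom_fin fproper dx) fy -EFinD lee_fin.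
by have := bregman_ge0 dx iy; rewrite /rbregman; lra.
Qed.

Lemma subdiff_idom x u : subdiff ip f x u -> idom f x.
Proof. by case: flegendre => -[<- _ _ _] _ h; exists u. Qed.

Lemma real_subdiff x u : dom f x ->
  (forall v, dom f v -> fr x + ip u (v - x) <= fr v) -> subdiff ip f x u.
Proof.
move=> dx h; split; first by rewrite (dom_fin fproper dx).
move=> v; have [dv|ndv] := pselect (dom f v); last by rewrite (notdom ndv) leey.
by rewrite (dom_fin fproper dx) (dom_fin fproper dv) -EFinD lee_fin h.
Qed.

Lemma three_point x p z :
  d x z = d x p + d p z + (ip (grad p) (x - p) - ip (grad z) (x - p)).
Proof.
rewrite /rbregman; have -> : x - z = (x - p) + (p - z) by rewrite addrA subrK.
rewrite (ipDr ipP (grad z)); ring.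
Qed.

Lemma bregman_convex z a b t : dom f a -> dom f b -> 0 <= t <= 1 ->
  dom f (t *: a + (1 - t) *: b) /\
  d (t *: a + (1 - t) *: b) z <= t * d a z + (1 - t) * d b z.
Proof.
move=> da db t01; have [dt ft] := dom_convex fproper fconvex da db t01.
split=> //; rewrite /rbregman !(ipE ipP); lra.
Qed.

(** The interior of the domain is convex and equals the domain of the subdifferential, so essential
    strict convexity applies to it as a whole. *)
Lemma idom_strict a b : idom f a -> idom f b -> a != b ->
  fr (2^-1 *: (a + b)) < (fr a + fr b) / 2.
Proof.
move=> ia ib ab.
have im : idom f (2^-1 *: (a + b)).
  by rewrite midpointE; apply: (idom_cvx fproper fconvex) => //; lra.
case: flegendre => -[dE _ _ _] [_ /(_ (idom f) (idom_cvx fproper fconvex))].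
rewrite dE => /(_ (@subset_refl _ _) a b 2^-1 ia ib ab).
rewrite -midpointE (dom_fin fproper (idom_dom ia)) (dom_fin fproper (idom_dom ib)).
rewrite (dom_fin fproper (idom_dom im)) -!EFinM -EFinD lte_fin.
have h2 : 0 < (2^-1 : R) < 1 by lra.
by move=> /(_ h2); lra.
Qed.

(** If the distance vanishes, [grad y] is also a subgradient at [x], so [x] is interior. Were [x]
    different from [y], strict convexity would make the distance from their midpoint to [y]
    negative. *)
Lemma bregman_eq0 x y : dom f x -> idom f y -> d x y = 0 -> x = y.
Proof.
move=> dx iy dxy; apply/eqP/negPn/negP => xy.
have ix : idom f x.
  apply: (@subdiff_idom _ (grad y)); apply: real_subdiff => // v dv.
  by have := bregman_ge0 dv iy; move: dxy; rewrite /rbregman !(ipE ipP); lra.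
have im : idom f (2^-1 *: (x + y)).
  by rewrite midpointE; apply: (idom_cvx fproper fconvex) => //; lra.
have := bregman_ge0 (idom_dom im) iy; have := idom_strict ix iy xy.
by move: dxy; rewrite /rbregman !(ipE ipP); lra.
Qed.

Definition sublevel z c : set H := [set x | dom f x /\ d x z <= c].

Lemma sublevel_cvx z c : cvx_set (sublevel z c).
Proof.
move=> a b t [da ac] [db bc] t01; have [dt ft] := bregman_convex z da db t01.
split=> //; apply: le_trans ft _; move: t01 => /andP[t0 t1].
have : t * d a z <= t * c by rewrite ler_wpM2l.
have : (1 - t) * d b z <= (1 - t) * c by rewrite ler_wpM2l // subr_ge0.
lra.
Qed.

Lemma ip_cvgr {T : Type} (F : set_system T) {FF : Filter F} (u : T -> H) x h :
  u @ F --> x -> (fun k => ip h (u k)) @ F --> ip h x.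
Proof.
move=> ux; rewrite (ipC ipP); under eq_cvg do rewrite (ipC ipP).
exact: (ip_cvg ipP).
Qed.

(** The condition compares [f] with a continuous affine function of [x], so lower semicontinuity of
    [f] suffices. *)
Lemma sublevel_closed z c : closed (sublevel z c).
Proof.
move=> x xc; set c' := c + fr z - ip (grad z) z.
have fxc : (f x <= (c' + ip (grad z) x)%:E)%E.
  rewrite leNgt; apply/negP => lfx.
  have [a la afx] : exists2 a, c' + ip (grad z) x < a & (a%:E < f x)%E.
    move: lfx; set l := _ + _; case: (f x) => [r| |] //.
      rewrite lte_fin => lr; exists ((l + r) / 2); rewrite ?lte_fin; lra.
    by move=> _; exists (l + 1); rewrite ?ltry // ltrDl.
  have [V Vx Va] := flsc afx.
  have e0 : 0 < a - (c' + ip (grad z) x) by rewrite subr_gt0.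
  have near_x : (fun v => ip (grad z) v) @ x --> ip (grad z) x.
    by apply: ip_cvgr; exact: cvg_id.
  move/cvgrPdist_lt : near_x => /(_ _ e0) near_x.
  have [v [[dv dvc] [Vv]]] := xc _ (filterI Vx near_x).
  move: (Va v Vv); rewrite /= (dom_fin fproper dv) lte_fin => av.
  have := ler_norm (- (ip (grad z) x - ip (grad z) v)); rewrite normrN.
  by move: dvc av; rewrite /rbregman /c' !(ipE ipP); lra.
have dx : dom f x by apply: le_lt_trans fxc _; exact: ltry.
split=> //; move: fxc; rewrite (dom_fin fproper dx) lee_fin /c' /rbregman !(ipE ipP).
lra.
Qed.

End Bregman.

(** * Bregman projections *)

Section Projection.
Variables (R : realType) (H : completeNormedModType R) (ip : H -> H -> R).
Variable f : H -> \bar R.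
Hypotheses (ipP : inner_product ip) (fproper : proper_fun f).
Hypotheses (flsc : lower_semicontinuous f) (fconvex : convex_fun f).
Hypothesis flegendre : legendre ip f.

Local Notation fr x := (fine (f x)).
Local Notation grad := (grad ip f).
Local Notation d := (rbregman ip f).

Lemma prox_exists z x k : idom f z -> 0 < k ->
  exists2 w, dom f w & forall v, dom f v ->
    d w z + k * `|w - x| ^+ 2 <= d v z + k * `|v - x| ^+ 2.
Proof.
move=> iz k0.
apply: (@strongly_convex_min _ _ _ (fun w => d w z + k * `|w - x| ^+ 2) 0 (k / 4)).
- by exists z; exact: idom_dom.
- by rewrite divr_gt0.
- move=> v dv; apply: addr_ge0; last by rewrite mulr_ge0 ?sqr_ge0 // ltW.
  exact: (bregman_ge0 ipP).
- move=> a b da db.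
  have [|dm dle] := bregman_convex ipP fproper fconvex z da db (t := 2^-1); first by lra.
  rewrite -midpointE in dm dle; split=> //.
  have := congr1 ( *%R k) (parallelogram ipP x a b); move: dle.
  move: (d _ z) (d a z) (d b z) (`|_| ^+ 2) (`|_| ^+ 2) (`|_| ^+ 2) (`|_| ^+ 2).
  by move=> *; nra.
- move=> u v l du uv ul.
  have uv2 : (fun n => `|u n - x| ^+ 2) @ \oo --> `|v - x| ^+ 2 by exact: sqr_dist_cvg.
  have uv3 : (fun n => ip (grad z) (u n - z)) @ \oo --> ip (grad z) (v - z).
    by apply: (ip_cvgr ipP); apply: cvgB => //; exact: cvg_cst.
  have [|dv] := lsc_seq fproper flsc du uv
    (l := l - k * `|v - x| ^+ 2 + fr z + ip (grad z) (v - z)).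
    have -> : (fun n => fr (u n)) = (fun n => (d (u n) z + k * `|u n - x| ^+ 2) -
        k * `|u n - x| ^+ 2 + fr z + ip (grad z) (u n - z)).
      by apply/funext => n; rewrite /rbregman; ring.
    apply: cvgD => //; apply: cvgD; last exact: cvg_cst.
    by apply: cvgB => //; apply: cvgM => //; exact: cvg_cst.
  by move=> fv; split=> //; rewrite /rbregman; lra.
Qed.

(** First-order condition for the proximal problem, tested along the segment from [w] to [v]; the
    quadratic penalty leaves a remainder of order [t^2]. *)
Lemma prox_subdiff z x k w : idom f z -> dom f w ->
  (forall v, dom f v ->
    d w z + k * `|w - x| ^+ 2 <= d v z + k * `|v - x| ^+ 2) ->
  subdiff ip f w (grad z + (2 * k) *: (x - w)).
Proof.
move=> iz dw wmin; apply: (real_subdiff fproper) => // v dv.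
suff : 0 <= d v z - d w z - 2 * k * ip (x - w) (v - w).
  by rewrite /rbregman !(ipE ipP); lra.
apply: (@ge0_of_small_slope _ _ (k * ip (v - w) (v - w))) => t /andP[t0 t1].
have t01 : 0 <= t <= 1 by rewrite (ltW t0).
have [dt dle] := bregman_convex ipP fproper fconvex z dv dw t01.
have := wmin _ dt.
have -> : t *: v + (1 - t) *: w - x = t *: (v - w) - (x - w) by vec_eq.
rewrite -(opprB x w) normrN -!(ip_sqr ipP) => h.
rewrite -(@pmulr_rge0 _ t) //.
move: (x - w) (v - w) h => a b; rewrite !(ipE ipP) (ipC ipP b a) => h.
by move: dle h; lra.
Qed.

(* A point [x] of the sublevel set is moved by its proximal point [w] by at most
   a fixed distance, and the subgradient found at [w] is close to [grad z], so
   [w] is bounded by local boundedness of the inverse subdifferential. *)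
Lemma sublevel_bounded z c : idom f z ->
  exists B, forall x, dom f x -> d x z <= c -> `|x| <= B.
Proof.
move=> iz; have [_ [/(_ (grad z)) lb _]] := flegendre.
have [|r [r0 [M MP]]] := lb.
  by exists z; exact: (grad_subdiff ipP).
have c1 : 0 < `|c| + 1 by apply: ltr_wpDl.
(* With this [k], the bound [k |w - x|^2 <= |c| + 1] gives [(2 k |w - x|)^2 <= r^2 / 2], so the
   subgradient at [w] lies within [r] of [grad z]. *)
pose k := r ^+ 2 / (8 * (`|c| + 1)).
have k0 : 0 < k by rewrite divr_gt0 ?exprn_gt0 ?mulr_gt0.
have kE : k * (`|c| + 1) = r ^+ 2 / 8 by rewrite /k; field; rewrite gt_eqF.
exists (M + r / (2 * k)) => x dx xc.
have [w dw wmin] := prox_exists x iz k0.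
have wc : k * `|w - x| ^+ 2 <= `|c| + 1.
  have := wmin _ dx; rewrite subrr normr0 expr0n mulr0 addr0.
  have := bregman_ge0 ipP fproper fconvex flegendre dw iz; have := ler_norm c.
  by move: (k * _) => *; lra.
have xw : 2 * k * `|x - w| < r.
  have nn : 0 <= 2 * k * `|w - x| by rewrite !mulr_ge0 // ltW.
  rewrite distrC -ltr_sqr ?nnegrE ?(ltW r0) //.
  have -> : (2 * k * `|w - x|) ^+ 2 = 4 * k * (k * `|w - x| ^+ 2) by ring.
  apply: le_lt_trans (_ : 4 * k * (`|c| + 1) < _).
    by rewrite ler_wpM2l // mulr_ge0 // ltW.
  by rewrite -mulrA kE; have := exprn_gt0 2 r0; lra.
have wM : `|w| <= M.
  apply: MP (prox_subdiff iz dw wmin).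
  by rewrite addrAC subrr add0r normrZ gtr0_norm // mulr_gt0.
have -> : x = w + (x - w) by rewrite addrC subrK.
apply: le_trans (ler_normD _ _) _; apply: lerD => //.
by rewrite ler_pdivlMr ?mulr_gt0 // mulrC ltW.
Qed.

(** A minimizing sequence stays in a bounded sublevel set, hence has a weak cluster point. That
    point lies in [A] and in every sublevel set above the infimum, all of these being convex and
    closed. *)
Lemma bregman_min_exists (A : set H) y z : cvx_set A -> closed A -> A y ->
  dom f y -> idom f z ->
  exists p, [/\ A p, dom f p & forall a, A a -> dom f a -> d p z <= d a z].
Proof.
move=> cA clA Ay dy iz.
pose S := [set d a z | a in A `&` dom f]; pose i := inf S.
have hi : has_inf S.
  split; first by exists (d y z), y.
  by exists 0 => _ [x [_ dx] <-]; exact: (bregman_ge0 ipP).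
have iS a : A a -> dom f a -> i <= d a z.
  by move=> Aa da; apply: ge_inf; [case: hi|exists a].
have /choice [u uP] : forall n : nat, exists x, [/\ A x, dom f x & d x z < i + n.+1%:R^-1].
  move=> n; have n0 : 0 < n.+1%:R^-1 :> R by rewrite invr_gt0 ltr0n.
  by have [_ [x [Ax dx] <-] xi] := inf_adherent n0 hi; exists x.
have inv_le n m : (n <= m)%N -> (m.+1%:R^-1 : R) <= n.+1%:R^-1.
  by move=> nm; rewrite lef_pV2 ?posrE ?ltr0n // ler_nat.
have [B BP] := sublevel_bounded (i + 1) iz.
have [|p [phi [phiS up]]] := @weak_seq_compact _ _ _ ipP u B.
  move=> k; have [_ dk dik] := uP k; apply: BP => //.
  by apply: le_trans (ltW dik) _; rewrite lerD2l invf_le1 ?ltr0n // ler1n.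
have pS n : A p /\ sublevel ip f z (i + n.+1%:R^-1) p.
  apply: (@cvx_weak_closed _ _ _ ipP (A `&` sublevel ip f z (i + n.+1%:R^-1)) _ _ _ _ _ up).
  - move=> a b t [Aa sa] [Ab sb] t01; split; first exact: cA.
    exact: (sublevel_cvx ipP).
  - by apply: closedI => //; exact: (sublevel_closed ipP).
  - exists n => // k /= nk; have [Ak dk dik] := uP (phi k); split=> //; split=> //.
    apply: le_trans (ltW dik) _; rewrite lerD2l.
    exact: inv_le (leq_trans nk (subseq_ge k phiS)).
exists p; split; [exact: (pS 0%N).1|exact: (pS 0%N).2.1|].
move=> a Aa da; apply: le_trans (iS _ Aa da).
apply/ler_addgt0Pr => e e0.
have [N _ /(_ N (leqnn N)) /= Ne] := near_infty_natSinv_lt (PosNum e0).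
by apply: le_trans (pS N).2.2 _; rewrite lerD2l ltW.
Qed.

(* If [p] were not interior, the gradients along the segment from [p] to an
   interior point [y] of [A] would blow up; but minimality bounds their slope
   from below, and boundedness of [f] near [y] then bounds their norm. *)
Lemma bregman_min_idom (A : set H) y z p : cvx_set A -> A y -> idom f y ->
  idom f z -> A p -> dom f p -> (forall a, A a -> dom f a -> d p z <= d a z) ->
  idom f p.
Proof.
move=> cA Ay iy iz Ap dp pmin; apply: contrapT => nip.
have [r r0 [M MP]] := idom_locally_bounded fproper flsc fconvex iy.
pose t n : R := n.+1%:R^-1; pose q n := t n *: y + (1 - t n) *: p.
have t0 n : 0 < t n by rewrite invr_gt0 ltr0n.
have t1 n : t n <= 1 by rewrite invf_le1 ?ltr0n // ler1n.
have iq n : idom f (q n).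
  by apply: (idom_segment fproper fconvex) => //; rewrite t0 t1.
have qp : q @ \oo --> p.
  have -> : q = (fun n => p + t n *: (y - p)) by apply/funext => n; rewrite /q; vec_eq.
  rewrite -[X in _ --> X]addr0 -[X in _ --> _ + X](scale0r (y - p)).
  apply: cvgD; first exact: cvg_cst.
  by apply: cvgZ; [exact: cvg_harmonic|exact: cvg_cst].
have blowup : (fun k => `|grad (q k)|) @ \oo --> +oo%R.
  by case: flegendre => -[_ _ _ h] _; exact: h iq qp (subset_closure dp) nip.
set B := M - fr p - ip (grad z) (y - p).
(* The bound 1 makes [g] nonzero, so that it can be normalized. The other bound gives
   [r |g| / 2 > B], while minimality at [p] and the subgradient inequalities at [q n] yield
   [r |g| / 2 <= B]. *)
move/cvgryPge : blowup => /(_ (Num.max 1 (2 * (B / r) + 1))) /filter_ex[n].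
rewrite ge_max => /andP[g1 gB].
move: (iq n) g1 gB; set g := grad (q n) => iqn g1 gB.
have g0 : 0 < `|g| by apply: lt_le_trans g1.
have Aq : A (q n) by apply: cA => //; rewrite t1 ltW.
have dq := idom_dom iqn; have tn0 := t0 n; have tn1 := t1 n.
have min_q := pmin _ Aq dq.
have slope_p := bregman_ge0 ipP fproper fconvex flegendre dp iqn.
(* Moving from [y] by [r / 2] along [g] stays where [f <= M] and raises the linearization at [q n]
   by [r |g| / 2]. *)
pose v := y + (r / 2 / `|g|) *: g.
have [|dv vM] := MP v.
  rewrite /v addrAC subrr add0r normrZ gtr0_norm ?divr_gt0 //.
  by rewrite divfK ?gt_eqF //; lra.
have slope_v := bregman_ge0 ipP fproper fconvex flegendre dv iqn.
have gg : ip g (v - q n) = r / 2 * `|g| + (1 - t n) * ip g (y - p).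
  have -> : v - q n = (r / 2 / `|g|) *: g + (1 - t n) *: (y - p).
    by rewrite /v /q; vec_eq.
  rewrite !(ipE ipP) (ip_sqr ipP); field.
  by rewrite gt_eqF.
have gp : ip g (p - q n) = - t n * ip g (y - p).
  have -> : p - q n = (- t n) *: (y - p) by rewrite /q; vec_eq.
  by rewrite !(ipE ipP); ring.
have zq : ip (grad z) (q n - z) = ip (grad z) (p - z) + t n * ip (grad z) (y - p).
  have -> : q n - z = (p - z) + t n *: (y - p) by rewrite /q; vec_eq.
  by rewrite !(ipE ipP); ring.
move: min_q slope_p slope_v; rewrite /rbregman -/g gg gp zq.
move: (ip g (y - p)) (ip (grad z) (y - p)) @B gB => G K B gB h1 h2 h3.
have GK : K <= G by rewrite -(ler_pM2l tn0); lra.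
have : (1 - t n) * K <= (1 - t n) * G by rewrite ler_wpM2l // subr_ge0.
have : r * (2 * (B / r) + 1) <= r * `|g| by rewrite ler_pM2l.
have -> : r * (2 * (B / r) + 1) = 2 * B + r by field; rewrite gt_eqF.
by rewrite /B; move: r0; lra.
Qed.

Lemma grad_minimizer w p z : idom f p -> idom f z ->
  (forall t, dom f (p + t *: w) -> d p z <= d (p + t *: w) z) ->
  ip (grad p) w = ip (grad z) w.
Proof.
have ge v : idom f p -> idom f z ->
    (forall t, dom f (p + t *: v) -> d p z <= d (p + t *: v) z) ->
    ip (grad z) v <= ip (grad p) v.
  move=> ip' iz h; apply: (grad_ge flegendre) => // t _ dt.
  by have := h t dt; rewrite /rbregman !(ipE ipP); lra.
move=> ip' iz h; apply/le_anti/andP; split; last exact: ge.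
rewrite -lerN2 -!(ipNr ipP); apply: ge => // t; rewrite scalerN -scaleNr; exact: h.
Qed.

(** Since the minimizer [p] is interior, stationarity along [W] cancels the gradient terms of
    [three_point], which leaves the Pythagorean identity. Any other minimizer [q] then satisfies
    [d q p <= 0], so it equals [p]. *)
Lemma bregman_projection (W : set H) y z : linear_subspace W -> closed W ->
  idom f y -> idom f z -> exists p, [/\ W (p - y), idom f p,
    bproj ip f [set v | W (v - y)] z = [set p] &
    forall x, W (x - y) -> d x z = d x p + d p z].
Proof.
move=> sW clW iy iz; set A := [set v | W (v - y)].
have Ay : A y by rewrite /A /= subrr; exact: sW.1.
have cA : cvx_set A.
  move=> a b t Aa Ab t01; rewrite /A /=.
  have -> : t *: a + (1 - t) *: b - y = t *: (a - y) + (1 - t) *: (b - y) by vec_eq.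
  exact: (subspace_cvx sW).
have clA : closed A.
  by apply: preimage_closed => // x _; apply: cvgB; [exact: cvg_id|exact: cvg_cst].
have dy := idom_dom iy.
have [p [Ap dp pmin]] := bregman_min_exists cA clA Ay dy iz.
have min_idom q : A q -> dom f q -> (forall a, A a -> dom f a -> d q z <= d a z) ->
    idom f q by move=> *; exact: (bregman_min_idom cA Ay iy iz).
have ip' := min_idom _ Ap dp pmin.
have pyth x : A x -> d x z = d x p + d p z.
  move=> Ax; rewrite (three_point f ipP x p z).
  suff -> : ip (grad p) (x - p) = ip (grad z) (x - p) by rewrite subrr addr0.
  apply: grad_minimizer => // t dt.
  apply: pmin => //; rewrite /A /=.
  have -> : p + t *: (x - p) - y = t *: (x - y) + (1 - t) *: (p - y) by vec_eq.
  by apply: sW.2 => //; exact: subspaceZ.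
exists p; split=> //; apply/seteqP; split => q /=.
  move=> [Aq [dq qmin]].
  have : d q z <= d p z.
    by have := qmin _ Ap; rewrite !(bregmanE ip fproper _ iz) // lee_fin.
  rewrite pyth // => h; apply: (bregman_eq0 ipP fproper fconvex flegendre dq ip').
  apply/le_anti; rewrite (bregman_ge0 ipP fproper fconvex flegendre dq ip') andbT.
  by move: h; lra.
move=> ->; split=> //; split=> // c Ac; have [dc|ndc] := pselect (dom f c).
  by rewrite !(bregmanE ip fproper _ iz) // lee_fin; exact: pmin.
by rewrite (bregman_notdom ip fproper z ndc) leey.
Qed.

End Projection.

(** * Circumcenters of isometries *)

Section Circumcenter.
Variables (R : realType) (H : completeNormedModType R) (ip : H -> H -> R).
Variables (f : H -> \bar R) (m : nat) (T : 'I_m -> H -> H).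
Hypotheses (ipP : inner_product ip) (fproper : proper_fun f).
Hypotheses (flsc : lower_semicontinuous f) (fconvex : convex_fun f).
Hypothesis flegendre : legendre ip f.
Hypothesis Tiso : forall i, bregman_isometric ip f (T i).
Hypothesis CC_unique : forall u, idom f u ->
  forall v w, CC ip f T u v -> CC ip f T u w -> v = w.

Local Notation fr x := (fine (f x)).
Local Notation grad := (grad ip f).
Local Notation d := (rbregman ip f).
Local Notation F := (idom f `&` FixAll T).
Local Notation cc := (CCpt ip f T).

Lemma isometric_fix x z i : dom f x -> F z ->
  bregman ip f x z = bregman ip f (T i x) z.
Proof.
by move=> dx [iz /(_ i I) Tz]; have [_ _ <-] := Tiso i dx iz; rewrite Tz.
Qed.

Lemma isometric_idom u i : idom f u -> idom f (T i u).
Proof. by move=> iu; have [] := Tiso i (idom_dom iu) iu. Qed.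

(** As [CC] does not involve [z], all points [z] of [F] have the same projection on the affine
    hull. *)
Lemma CC_projection u z : idom f u -> F z -> exists p,
  [/\ CC ip f T u = [set p], bproj ip f (aff (Sset T u)) z = [set p], idom f p,
      d u z = d u p + d p z & forall i, d (T i u) p = d u p].
Proof.
move=> iu Fz; have [iz _] := Fz; have du := idom_dom iu.
pose W := finspan (fun i => T i u - u).
have sW : linear_subspace W := finspan_subspace _.
have clW : closed W := @finspan_closed _ _ _ ipP _ _.
have [p [Wp ip' bp pyth]] := bregman_projection ipP fproper flsc fconvex flegendre
  sW clW iu iz.
have WT i : W (T i u - u) by exact: (finspan_mem (fun i => T i u - u)).
have Wu : W (u - u) by rewrite subrr; exact: sW.1.
have dT i : d (T i u) p = d u p.
  have dTu := idom_dom (isometric_idom i iu).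
  have := isometric_fix i du Fz.
  rewrite (bregmanE ip fproper du iz) (bregmanE ip fproper dTu iz).
  by rewrite (pyth _ Wu) (pyth _ (WT i)) => -[/addIr].
exists p; split=> //; last 2 first.
- by rewrite (aff_Sset ipP).
- exact: pyth.
have CCp : CC ip f T u p.
  split; first by rewrite (aff_Sset ipP).
  split=> // i; rewrite !(bregmanE ip fproper _ ip') ?dT //.
  exact: idom_dom (isometric_idom i iu).
by apply/seteqP; split => q /= => [CCq|->] //; exact: CC_unique CCq CCp.
Qed.

Lemma CCptP u z : idom f u -> F z ->
  [/\ CC ip f T u = [set cc u], idom f (cc u), d u z = d u (cc u) + d (cc u) z &
      forall i, d (T i u) (cc u) = d u (cc u)].
Proof.
move=> iu Fz; have [p [CCp _ ip' pyth dT]] := CC_projection iu Fz.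
have -> : cc u = p.
  have : CC ip f T u (cc u) by apply: (xgetPex u); exists p; rewrite CCp.
  by rewrite CCp.
by [].
Qed.

(** At a common fixed point all the spanning vectors [T i x - x] vanish and the affine hull reduces
    to [x]. *)
Lemma CCpt_fix x : F x -> cc x = x.
Proof.
move=> Fx; have [ix fx] := Fx; have [CCx _ _ _] := CCptP ix Fx.
have [] : CC ip f T x (cc x) by rewrite CCx.
rewrite (aff_Sset ipP) => -[l lE] _; apply/eqP; rewrite -subr_eq0 lE big1 // => i _.
by rewrite (fx i I) subrr scaler0.
Qed.

(** Equidistance turns the required limits for the [T j (u k)] into the one assumed for [u k].
    Concluding [F x] serves both demiclosedness of the circumcenter map and the location of weak
    cluster points. *)
Lemma demiclosed_CC_fix (z : H) x (u : nat -> H) : F z ->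
  (forall i, f_demiclosed ip f (T i) setT) ->
  (forall v : nat -> H, (forall k, idom f (v k)) ->
    (fun k => bregman ip f (v k) (cc (v k))) @ \oo --> 0%E ->
    (forall i, (fun k => bregman ip f (T i (v k)) (cc (v k))) @ \oo --> 0%E) ->
    forall i, (fun k => bregman ip f (v k) (T i (v k))) @ \oo --> 0%E) ->
  idom f x -> (forall k, idom f (u k)) -> weak_cvg ip u x ->
  (fun k => bregman ip f (u k) (cc (u k))) @ \oo --> 0%E -> F x.
Proof.
move=> Fz Tdemi key ix iu ux ucc; split=> // i _.
apply: (Tdemi i x u) => // [k|]; first exact: isometric_idom.
apply: key => // j.
have -> : (fun k => bregman ip f (T j (u k)) (cc (u k))) =
          (fun k => bregman ip f (u k) (cc (u k))).
  apply/funext => k; have [_ icc _ dT] := CCptP (iu k) Fz.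
  rewrite !(bregmanE ip fproper _ icc) ?dT //; first exact: idom_dom.
  exact: idom_dom (isometric_idom j (iu k)).
exact: ucc.
Qed.

(** * The sequence of iterated circumcenters *)

Section Iterates.
Variables (y z0 : H).
Hypotheses (iy : idom f y) (Fz0 : F z0).
Local Notation xs := (fun k => iter k cc y).

Lemma iter_idom k : idom f (xs k).
Proof. by elim: k => //= k IH; have [] := CCptP IH Fz0. Qed.

Lemma iter_pythagoras k z : F z ->
  d (xs k) z = d (xs k) (xs k.+1) + d (xs k.+1) z.
Proof. by move=> Fz; have [] := CCptP (iter_idom k) Fz. Qed.

Lemma iter_bregman_ge0 k z : idom f z -> 0 <= d (xs k) z.
Proof. by move=> iz; apply: (bregman_ge0 ipP) => //; exact: idom_dom (iter_idom k). Qed.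

Lemma iter_bregman_le k z : F z -> d (xs k.+1) z <= d (xs k) z.
Proof.
by move=> Fz; rewrite [leRHS]iter_pythagoras // lerDr iter_bregman_ge0 //; exact: iter_idom.
Qed.

Lemma iter_bregman_cvg z : F z -> exists l : R, (fun k => d (xs k) z) @ \oo --> l.
Proof.
move=> Fz; apply/cvg_ex; apply: nonincreasing_is_cvgn.
  by apply/nonincreasing_seqP => k; exact: iter_bregman_le.
by exists 0 => _ [k _ <-]; apply: iter_bregman_ge0; exact: Fz.1.
Qed.

Lemma iter_step_cvg : (fun k => d (xs k) (xs k.+1)) @ \oo --> 0.
Proof.
have [l al] := iter_bregman_cvg Fz0.
have -> : (fun k => d (xs k) (xs k.+1)) =
    (fun k => d (xs k) z0 - d (xs k.+1) z0).
  by apply/funext => k; rewrite (iter_pythagoras k Fz0) addrK.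
rewrite -(subrr l); apply: cvgB => //.
by have := al; rewrite -(cvg_shiftS (fun k => d (xs k) z0)).
Qed.

Lemma iter_bounded : exists B, forall k, `|xs k| <= B.
Proof.
have [B BP] := sublevel_bounded ipP fproper flsc fconvex flegendre (d y z0) Fz0.1.
exists B => k; apply: BP; first exact: idom_dom (iter_idom k).
by elim: k => // k IH; apply: le_trans (iter_bregman_le k Fz0) IH.
Qed.

(* Both distances [d (xs k) p] and [d (xs k) q] converge, hence so does
   [ip (xs k) (grad p - grad q)]; comparing its limits along the two subsequences
   gives [ip (p - q) (grad p - grad q) = 0]. *)
Lemma iter_cluster_unique p q : F p -> F q ->
  weak_cluster ip xs p -> weak_cluster ip xs q -> p = q.
Proof.
move=> Fp Fq [phi [phiS xp]] [psi [psiS xq]].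
have [lp ap] := iter_bregman_cvg Fp; have [lq aq] := iter_bregman_cvg Fq.
pose c := fr q - fr p + ip (grad p) p - ip (grad q) q.
have lim : (fun k => ip (xs k) (grad p - grad q)) @ \oo --> c - (lp - lq).
  have -> : (fun k => ip (xs k) (grad p - grad q)) =
      (fun k => c - (d (xs k) p - d (xs k) q)).
    apply/funext => k; rewrite /rbregman /c; move: (iter k _ _) => v.
    by rewrite !(ipE ipP) !(ipC ipP v); ring.
  by apply: cvgB; [exact: cvg_cst|exact: cvgB].
have pl := cvg_unique _ (xp (grad p - grad q)) (cvg_subseq phiS lim).
have ql := cvg_unique _ (xq (grad p - grad q)) (cvg_subseq psiS lim).
have dp := idom_dom Fp.1; have dq := idom_dom Fq.1.
(* The sum [d p q + d q p] equals [ip (p - q) (grad p - grad q)], which is 0; both terms are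
   nonnegative, so both vanish. *)
apply: (bregman_eq0 ipP fproper fconvex flegendre dp Fq.1).
have := bregman_ge0 ipP fproper fconvex flegendre dp Fq.1.
have := bregman_ge0 ipP fproper fconvex flegendre dq Fp.1.
have : ip p (grad p - grad q) = ip q (grad p - grad q) by rewrite pl // ql.
rewrite /rbregman !(ipE ipP) !(ipC ipP p) !(ipC ipP q).
move=> ? ? ?; apply/le_anti; apply/andP; split; lra.
Qed.

End Iterates.
End Circumcenter.

Local Open Scope ereal_scope.
Theorem theorem4p12 (R : realType) (H : completeNormedModType R)
  (ip : H -> H -> R) (f : H -> \bar R) (m : nat) (T : 'I_m -> H -> H)
  (y : H) :
  inner_product ip ->
  proper_fun f -> lower_semicontinuous f -> convex_fun f -> legendre ip f ->
  let F := idom f `&` FixAll T in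
  F !=set0 -> closed F -> cvx_set F ->
  (forall i, bregman_isometric ip f (T i)) ->
  (forall u, idom f u -> forall v w, CC ip f T u v -> CC ip f T u w -> v = w) ->
  idom f y ->
  let xs := fun k => iter k (CCpt ip f T) y in
  (* (i) *)
  (forall x z, dom f x -> F z ->
     forall i, bregman ip f x z = bregman ip f (T i x) z) /\
  (* (ii) *)
  (forall z, F z -> exists p, [/\ CC ip f T y = [set p],
        bproj ip f (aff (Sset T y)) z = [set p] & idom f p]) /\
  (* (iii) *)
  (forall k, idom f (xs k) /\ CC ip f T (xs k) = [set xs k.+1]) /\
  (* (iv) *)
  forward_bregman_monotone ip f (FixAll T) xs /\
  (forall z, F z -> exists l : R,
     (fun k => bregman ip f (xs k) z) @ \oo --> l%:E) /\
  (* (v) *)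
  (fun k => bregman ip f (xs k) (xs k.+1)) @ \oo --> 0 /\
  (* (vi) *)
  ((forall i, f_demiclosed ip f (T i) setT) ->
   (forall u : nat -> H, (forall k, idom f (u k)) ->
      (fun k => bregman ip f (u k) (CCpt ip f T (u k))) @ \oo --> 0 ->
      (forall i, (fun k => bregman ip f (T i (u k)) (CCpt ip f T (u k)))
                   @ \oo --> 0) ->
      forall i, (fun k => bregman ip f (u k) (T i (u k))) @ \oo --> 0) ->
   f_demiclosed ip f (CCpt ip f T) (idom f) /\
   ((forall p, weak_cluster ip xs p -> idom f p) ->
    exists2 p, F p & weak_cvg ip xs p)).
Proof.
move=> ipP fproper flsc fconvex flegendre F [z0 Fz0] _ _ Tiso CCu iy xs.
have i_xs k : idom f (xs k) by exact: (iter_idom ipP fproper flsc fconvex flegendre Tiso CCu iy Fz0).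
have bE k z : F z -> bregman ip f (xs k) z = (rbregman ip f (xs k) z)%:E.
  by move=> [iz _]; rewrite (bregmanE ip fproper) //; exact: idom_dom (i_xs k).
have sE : (fun k => bregman ip f (xs k) (xs k.+1)) =
          (fun k => (rbregman ip f (xs k) (xs k.+1))%:E).
  by apply/funext => k; rewrite (bregmanE ip fproper) //; exact: idom_dom (i_xs k).
have step : (fun k => bregman ip f (xs k) (xs k.+1)) @ \oo --> 0.
  rewrite sE; apply: cvg_EFin; first exact: nearW.
  exact: (iter_step_cvg ipP fproper flsc fconvex flegendre Tiso CCu iy Fz0).
split; first by move=> x z dx Fz i; exact: isometric_fix.
split.
  move=> z Fz.
  have [p [? ? ? _ _]] := CC_projection ipP fproper flsc fconvex flegendre Tiso CCu iy Fz.
  by exists p.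
split.
  move=> k; split=> //.
  by have [] := CCptP ipP fproper flsc fconvex flegendre Tiso CCu (i_xs k) Fz0.
split.
  split=> //; first by exists z0; split; [exact: Fz0.2|exact: Fz0.1].
  move=> c k Cc ic; have Fc : F c by [].
  rewrite !bE // lee_fin.
  exact: (iter_bregman_le ipP fproper flsc fconvex flegendre Tiso CCu iy Fz0).
split.
  move=> z Fz.
  have [l al] := iter_bregman_cvg ipP fproper flsc fconvex flegendre Tiso CCu iy Fz0 Fz.
  exists l; have -> : (fun k => bregman ip f (xs k) z) =
      (fun k => (rbregman ip f (xs k) z)%:E) by apply/funext => k; exact: bE.
  by apply: cvg_EFin; [exact: nearW|exact: al].
split=> // Tdemi key.
have demi := demiclosed_CC_fix ipP fproper flsc fconvex flegendre Tiso CCu Fz0 Tdemi key.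
split.
  move=> x u _ ix iu _ ux ucc.
  exact: (CCpt_fix ipP fproper flsc fconvex flegendre Tiso CCu (demi _ _ ix iu ux ucc)).
move=> xs_cluster.
(* Consecutive distances tend to 0 along any subsequence too, so the demiclosedness argument applies
   to the subsequence that converges weakly to [p]. *)
have clusterF p : weak_cluster ip xs p -> F p.
  move=> wp; have [phi [phiS xp]] := wp.
  apply: (demi _ (xs \o phi)) (xs_cluster _ wp) _ xp _; first by move=> k; exact: i_xs.
  exact: (cvg_subseq phiS step).
have [B xB] := iter_bounded ipP fproper flsc fconvex flegendre Tiso CCu iy Fz0.
have [p wp] := weak_seq_compact ipP xB.
exists p; first exact: clusterF.
apply: (weak_cvg_unique_cluster ipP xB) => q wq.
by apply: (iter_cluster_unique ipP fproper flsc fconvex flegendre Tiso CCu iy Fz0);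
  rewrite //; exact: clusterF.
Qed.
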